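(* For every constant $\varepsilon>0$ there exists an integer $k(\varepsilon)$ such that for every $k\ge k(\varepsilon)$ and every $n\ge k$ there exists a $k$-junta $f:\mathbb{Z}_2^n\to\mathbb{Z}_2$ which is not $q$-locally correctable for $\varepsilon$, for any number of queries $q$.
   Context: For $f:\mathbb{Z}_2^n\to\mathbb{Z}_2$ and a permutation $\sigma\in\mathcal{S}_n$, let $f_\sigma(x_1,\dots,x_n)=f(x_{\sigma(1)},\dots,x_{\sigma(n)})$; such an $f_\sigma$ is called an isomorphism of $f$. Two functions $f,g:\mathbb{Z}_2^n\to\mathbb{Z}_2$ are $\varepsilon$-close if $\Pr_x[f(x)\ne g(x)]\le\varepsilon$ for uniformly random $x\in\mathbb{Z}_2^n$. Local correction: $f$ (known to the algorithm) is $q$-locally correctable for $\varepsilon>0$ if there is a randomized algorithm which, for every $\sigma\in\mathcal{S}_n$, every $g$ that is $\varepsilon$-close to $f_\sigma$, and every $x\in\mathbb{Z}_2^n$, given $x$ and black-box (query) access to $g$ (but not $\sigma$), outputs $f_\sigma(x)$ with probability at least $2/3$ using at most $q$ queries to $g$. A $k$-junta is a function depending only on (at most) $k$ of its input variables. *)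

(* Defs.v *)
From HB Require Import structures.
From mathcomp Require Import all_boot all_order all_algebra all_fingroup.
From mathcomp Require Import all_classical all_reals all_analysis.

Set Implicit Arguments.
Unset Strict Implicit.
Unset Printing Implicit Defensive.

Import Order.TTheory GRing.Theory Num.Theory.
Local Open Scope classical_set_scope.
Local Open Scope ring_scope.

Definition cube (n : nat) := 'rV['Z_2]_n.

(* [col_perm s x] has i-th coordinate [x 0 (s i)]. *)
Definition isomorphic_copy (n : nat) (f : cube n -> 'Z_2) (s : 'S_n) :
    cube n -> 'Z_2 :=
  fun x => f (col_perm s x).

Definition prob_neq (R : realType) (n : nat) (f g : cube n -> 'Z_2) : R :=
  #|[set x : cube n | f x != g x]%SET|%:R / #|[set: cube n]%SET|%:R.

Definition eps_close (R : realType) (n : nat) (eps : R) (f g : cube n -> 'Z_2) :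
    Prop :=
  prob_neq R f g <= eps.

Definition junta (n k : nat) (f : cube n -> 'Z_2) : Prop :=
  exists2 J : {set 'I_n}, (#|J| <= k)%N &
    forall x y : cube n, (forall i, i \in J -> x 0 i = y 0 i) -> f x = f y.

(* Deterministic, adaptive computations with black-box access to a function
   on the cube: the only way to obtain information about it is [Query]. *)
Inductive query_tree (n : nat) : Type :=
  | Output of 'Z_2
  | Query of cube n & ('Z_2 -> query_tree n).

Fixpoint run (n : nat) (t : query_tree n) (g : cube n -> 'Z_2) : 'Z_2 :=
  match t with
  | Output b => b
  | Query y c => run (c (g y)) g
  end.

Fixpoint num_queries (n : nat) (t : query_tree n) (g : cube n -> 'Z_2) : nat :=
  match t with
  | Output _ => 0
  | Query y c => (num_queries (c (g y)) g).+1
  end.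

(* A randomized algorithm draws its randomness from an arbitrary probability
   space; the input [x] and the random outcome determine its query tree.
   There are only countably many query trees, so they carry the discrete
   sigma-algebra. *)
Record rand_algo (R : realType) (n : nat) := RandAlgo {
  seed_display : measure_display;
  seed : measurableType seed_display;
  seed_prob : probability seed R;
  algo_tree : cube n -> seed -> query_tree n;
  algo_tree_measurable : forall (x : cube n) (D : set (query_tree n)),
    measurable (algo_tree x @^-1` D)
}.

Definition locally_correctable (R : realType) (n q : nat) (eps : R)
    (f : cube n -> 'Z_2) : Prop :=
  exists A : rand_algo R n,
    forall (s : 'S_n) (g : cube n -> 'Z_2) (x : cube n),
      eps_close eps g (isomorphic_copy f s) ->
      ((2 / 3)%:E <=
         seed_prob A
           [set w | run (algo_tree x w) g = isomorphic_copy f s x])%E /\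
      (forall w : seed A, (num_queries (algo_tree x w) g <= q)%N).

(* Main.v *)
(** Take [f] to be the indicator that the first [k] coordinates are [1,0,...,0].
    It is not symmetric, yet each of its isomorphisms is nonzero with
    probability only [2^-k].  So the zero function is [eps]-close to two
    isomorphisms of [f] which differ at some [x], and no algorithm can output
    both values at [x] with probability [2/3] on the same oracle. *)
Require Import Defs.
From HB Require Import structures.
From mathcomp Require Import all_boot all_order all_algebra all_fingroup.
From mathcomp Require Import all_classical all_reals all_analysis.
From mathcomp Require Import lra.

Set Implicit Arguments.
Unset Strict Implicit.
Unset Printing Implicit Defensive.

Import Order.TTheory GRing.Theory Num.Theory.
Local Open Scope ring_scope.

(** Were the two values distinct, the events that the algorithm outputs one or the other on oracle
    [g] would be disjoint, each of probability at least 2/3, for a total of 4/3 > 1. *)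
Lemma locally_correctable_eq (R : realType) (n q : nat) (eps : R)
    (f g : cube n -> 'Z_2) (s t : 'S_n) (x : cube n) :
  locally_correctable q eps f ->
  eps_close eps g (isomorphic_copy f s) ->
  eps_close eps g (isomorphic_copy f t) ->
  isomorphic_copy f s x = isomorphic_copy f t x.
Proof.
move=> [A corrA] gs gt; apply/eqP/negPn/negP => /eqP neq.
have [Ps _] := corrA s g x gs; have [Pt _] := corrA t g x gt.
set Es := [set w | _]%classic in Ps; set Et := [set w | _]%classic in Pt.
have mE b : measurable [set w | run (@algo_tree _ _ A x w) g = b]%classic.
  exact: (algo_tree_measurable A x [set tr | run tr g = b]%classic).
have dE : (Es `&` Et = set0)%classic.
  by apply/seteqP; split=> // w []; rewrite /Es /Et /= => -> /neq.
have : (seed_prob A (Es `|` Et)%classic <= 1)%E.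
  by apply: probability_le1; apply: measurableU; exact: mE.
rewrite measureU//; [|exact: mE..].
move=> /(le_trans (leeD Ps Pt)).
by rewrite -EFinD lee_fin; lra.
Qed.

Definition prefix_indicator (k m : nat) (d : 'rV['Z_2]_k) : cube (k + m) -> 'Z_2 :=
  fun x => (lsubmx x == d)%:R.

Lemma prefix_indicator_junta (k m : nat) (d : 'rV['Z_2]_k) :
  junta k (@prefix_indicator k m d).
Proof.
exists [set lshift m i | i in 'I_k]%SET.
  by rewrite (leq_trans (leq_imset_card _ _)) ?card_ord.
move=> x y xy; rewrite /prefix_indicator; congr ((_ == _)%:R).
by apply/rowP => i; rewrite !mxE xy ?imset_f.
Qed.

(** The left block of [col_perm s x] must equal [d], so only the right block is free: at most
    [2 ^ m] of the [2 ^ (k + m)] points qualify. *)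
Lemma prob_neq0_prefix_indicator (R : realType) (k m : nat) (d : 'rV['Z_2]_k)
    (s : 'S_(k + m)) :
  prob_neq R (fun=> 0) (isomorphic_copy (@prefix_indicator k m d) s)
    <= (2 ^+ k)^-1.
Proof.
rewrite /prob_neq.
set A := [set x | _]%SET.
have cA : (#|A| <= 2 ^ m)%N.
  have -> : (2 ^ m = #|[set: 'rV['Z_2]_m]%SET|)%N.
    by rewrite cardsT card_mx card_ord mul1n.
  apply: leq_trans (leq_imset_card (fun v => col_perm s^-1 (row_mx d v)) _).
  apply: subset_leq_card; apply/fintype.subsetP => x.
  rewrite inE /isomorphic_copy /prefix_indicator.
  have [<- _|] := eqVneq (lsubmx (col_perm s x)) d; last by rewrite eqxx.
  apply/imsetP; exists (rsubmx (col_perm s x)); first by rewrite inE.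
  by rewrite hsubmxK -col_permM mulVg col_perm1.
rewrite cardsT card_mx card_ord mul1n natrX exprD.
rewrite ler_pdivrMr ?mulr_gt0 ?exprn_gt0// mulKf ?expf_neq0 ?pnatr_eq0//.
by rewrite -natrX ler_nat.
Qed.

Theorem proposition1p3 (R : realType) (eps : R) (heps : 0 < eps) :
  exists k0 : nat, forall k n : nat, (k0 <= k)%N -> (k <= n)%N ->
    exists f : cube n -> 'Z_2,
      junta k f /\ forall q : nat, ~ locally_correctable q eps f.
Proof.
(* This bound gives [eps^-1 < k < 2 ^ k], and also [2 <= k], so that there are two prefix
   coordinates to swap. *)
exists (Num.truncn eps^-1).+2 => k n k0k kn.
have k_eps : (2 ^+ k)^-1 <= eps.
  rewrite invf_ple ?posrE ?exprn_gt0//.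
  apply: le_trans (ltW (truncnS_gt _)) _.
  by rewrite -natrX ler_nat (leq_trans (ltnW k0k))// ltnW// ltn_expl.
case: k => [|[|k]] // in k0k kn k_eps *.
rewrite -(subnKC kn); set m := (n - _)%N.
pose d : 'rV['Z_2]_k.+2 := delta_mx 0 0.
pose f : cube (k.+2 + m) -> 'Z_2 := prefix_indicator d.
exists f; split=> [|q corr]; first exact: prefix_indicator_junta.
have close s : eps_close eps (fun=> 0) (isomorphic_copy f s).
  exact: le_trans (prob_neq0_prefix_indicator _ _ _) k_eps.
pose i1 : 'I_k.+2 := lift ord0 ord0.
pose s : 'S_(k.+2 + m) := tperm (lshift m ord0) (lshift m i1).
(* At the point [(d, 0)] the identity copy is 1. Swapping the first two coordinates puts a 0 where
   [d] has its only 1, so the copy by [s] is 0 there. *)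
have := locally_correctable_eq (row_mx d 0) corr (close 1%g) (close s).
rewrite /isomorphic_copy /f /prefix_indicator col_perm1 row_mxKl eqxx.
case: eqVneq => // /rowP/(_ ord0).
by rewrite mxE mxE tpermL row_mxEl !mxE.
Qed.
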